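(* Let $A$ be a real $2\times 2$ symmetric matrix. Then the trace of $A$ is nonnegative if and only if $A$ has at most one negative eigenvalue, which, if it exists, is no larger in absolute value than the other eigenvalue of $A$. Thus, the trace of $A$ is nonnegative if and only if $A$ is of maximal trace over rotation matrices.
   Context: A rotation matrix is a real orthogonal matrix of determinant one. A real $d\times d$ matrix $M$ is said to be of maximal trace over rotation matrices if $\mathrm{tr}(M)\geq \mathrm{tr}(UM)$ for every $d\times d$ rotation matrix $U$. Eigenvalues are counted with multiplicity. *)

(* Defs.v *)
From mathcomp Require Import all_boot all_order all_algebra.
From mathcomp Require Import polyrcf reals.

Set Implicit Arguments.
Unset Strict Implicit.
Unset Printing Implicit Defensive.

Import Order.TTheory GRing.Theory Num.Theory.
Local Open Scope ring_scope.

(* Only real eigenvalues are listed, each repeated according to its algebraic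
   multiplicity. For a symmetric real matrix these are all the eigenvalues. *)
Definition real_eigenvalues (R : realType) (d : nat) (M : 'M[R]_d) : seq R :=
  flatten [seq nseq (mup x (char_poly M)) x | x <- rootsR (char_poly M)].

Lemma count_mem_real_eigenvalues (R : realType) (d : nat) (M : 'M[R]_d) (x : R) :
  count_mem x (real_eigenvalues M) = mup x (char_poly M).
Proof.
have pN0 : char_poly M != 0 by rewrite monic_neq0 // char_poly_monic.
rewrite /real_eigenvalues count_flatten -map_comp sumnE big_map.
under eq_bigr do rewrite /= count_nseq /=.
have Us : uniq (rootsR (char_poly M)) by exact: uniq_roots.
have Ms : (x \in rootsR (char_poly M)) = root (char_poly M) x.
  by have := roots_on_rootsR pN0 x; rewrite itv_boundlr /= => <-.
have [xs|xNs] := boolP (x \in rootsR (char_poly M)).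
  rewrite (bigD1_seq x) //= eqxx mul1n big1 ?addn0 // => y /negPf ->.
  by rewrite mul0n.
rewrite mupNroot -?Ms // big_seq big1 // => y ys.
by case: eqP ys xNs => [-> ->|_ _ _]; rewrite ?mul0n.
Qed.

Lemma mem_real_eigenvalues (R : realType) (d : nat) (M : 'M[R]_d) (x : R) :
  (x \in real_eigenvalues M) = eigenvalue M x.
Proof.
have pN0 : char_poly M != 0 by rewrite monic_neq0 // char_poly_monic.
rewrite eigenvalue_root_char root_factor_theorem XsubC_dvd //.
by rewrite -count_mem_real_eigenvalues -has_count has_pred1.
Qed.

Definition rotation_mx (R : realType) (d : nat) (U : 'M[R]_d) : Prop :=
  U *m U^T = 1%:M /\ \det U = 1.

Definition maximal_trace (R : realType) (d : nat) (M : 'M[R]_d) : Prop :=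
  forall U : 'M[R]_d, rotation_mx U -> \tr (U *m M) <= \tr M.

(* Main.v *)
Require Import Defs.
From mathcomp Require Import all_boot all_order all_algebra.
From mathcomp Require Import reals.
From mathcomp Require Import ring lra.

Import Order.TTheory GRing.Theory Num.Theory.
Local Open Scope ring_scope.

(** For a symmetric 2 x 2 matrix the discriminant of the characteristic
    polynomial is a sum of two squares, so there are exactly two real
    eigenvalues [a] and [b], with multiplicity, and [a + b = \tr A]. The
    eigenvalue condition only says, in terms of signs and absolute values, that
    [a + b] is nonnegative.

    For rotations, the 2 x 2 matrices of determinant one that are orthogonal
    have the form [[c, - s], [s, c]] with [c ^+ 2 + s ^+ 2 = 1]; the entries
    [s] and [- s] meet the equal off-diagonal entries of [A] and cancel, so
    [\tr (U *m A) = c * \tr A] with [c <= 1]. The largest value of [c * \tr A]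
    is [\tr A] exactly when [\tr A] is nonnegative, as the half turn [c = -1]
    shows. *)

(** Multiplicities in a product of linear factors are occurrence counts, so any
    splitting of the characteristic polynomial over the reals gives the whole
    list of eigenvalues. *)
Lemma perm_real_eigenvalues (R : realType) (d : nat) (M : 'M[R]_d)
    (s : seq R) :
  char_poly M = \prod_(x <- s) ('X - x%:P) -> perm_eq (real_eigenvalues M) s.
Proof.
move=> Mfact; apply/allP => x _ /=.
by rewrite count_mem_real_eigenvalues Mfact mu_prod_XsubC.
Qed.

Lemma mxtrace2 (R : pzSemiRingType) (M : 'M[R]_2) :
  \tr M = M 0 0 + M 1 1.
Proof.
by rewrite /mxtrace big_ord_recl big_ord1; congr (_ + M _ _); apply/val_inj.
Qed.

Lemma det_mx2 (R : comNzRingType) (M : 'M[R]_2) :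
  \det M = M 0 0 * M 1 1 - M 0 1 * M 1 0.
Proof.
rewrite (expand_det_row M 0) !big_ord_recl big_ord0 /cofactor !det_mx11 !mxE.
have -> : lift ord0 ord0 = 1 :> 'I_2 by apply/val_inj.
have -> : lift 1 0 = 0 :> 'I_2 by apply/val_inj.
by rewrite /= expr0 expr1; ring.
Qed.

(** The quadratic formula applies: with equal off-diagonal entries the
    discriminant [\tr A ^+ 2 - 4 * \det A] is the sum of squares [D]. *)
Lemma sym_mx2_eigenvalues (R : realType) (A : 'M[R]_2) :
  A^T = A ->
  exists a b : R, perm_eq (real_eigenvalues A) [:: a; b] /\ a + b = \tr A.
Proof.
move=> A_sym.
have A10 : A 1 0 = A 0 1 by rewrite -[in RHS]A_sym mxE.
pose D := (A 0 0 - A 1 1) ^+ 2 + (2 * A 0 1) ^+ 2.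
have D_ge0 : 0 <= D by rewrite addr_ge0 ?sqr_ge0.
pose a := (A 0 0 + A 1 1 + Num.sqrt D) / 2.
pose b := (A 0 0 + A 1 1 - Num.sqrt D) / 2.
have sumE : a + b = A 0 0 + A 1 1 by rewrite /a /b; field.
have prodE : a * b = A 0 0 * A 1 1 - A 0 1 * A 0 1.
  have : Num.sqrt D ^+ 2 = D by rewrite sqr_sqrtr.
  by rewrite /a /b; move: (Num.sqrt D) => r rE; rewrite /D in rE; lra.
exists a, b; split; last by rewrite mxtrace2.
apply: perm_real_eigenvalues.
rewrite /char_poly det_mx2 !mxE /= !big_cons big_nil A10.
transitivity ('X ^+ 2 - (a + b)%:P * 'X + (a * b)%:P : {poly R}).
  by rewrite sumE prodE; ring.
by ring.
Qed.

(** A rotation has its adjugate as inverse, hence as transpose. Both equations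
    between entries come at once: the sum of the squares of their defects is
    determined by the lengths of the rows and the determinant. *)
Lemma rotation_mx2_entries (R : realType) (U : 'M[R]_2) :
  rotation_mx U -> [/\ U 1 1 = U 0 0, U 0 1 = - U 1 0 & U 0 0 <= 1].
Proof.
case=> /matrixP UUt; rewrite det_mx2 => detU.
have := UUt 0 0; have := UUt 1 1.
rewrite !mxE !big_ord_recl !big_ord0 !mxE /=.
have -> : lift ord0 ord0 = 1 :> 'I_2 by apply/val_inj.
move: (U 0 0) (U 0 1) (U 1 0) (U 1 1) detU => p q r s detU n1 n0.
(* For an orthonormal pair of rows, the sum below is twice 1 - det U. *)
have : (s - p) ^+ 2 + (q + r) ^+ 2 == 0 by apply/eqP; lra.
rewrite paddr_eq0 ?sqr_ge0 // !sqrf_eq0 subr_eq0 addr_eq0.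
case/andP=> /eqP sE /eqP qE; split=> //.
by rewrite leNgt; apply/negP => p_gt1; nra.
Qed.

(** The off-diagonal entries of a plane rotation are opposite, so a symmetric
    matrix only sees its cosine [U 0 0]. *)
Lemma mxtrace_rotation_mx2 (R : realType) (U A : 'M[R]_2) :
  rotation_mx U -> A^T = A -> \tr (U *m A) = U 0 0 * \tr A.
Proof.
move=> /rotation_mx2_entries [U11 U01 _] A_sym.
have A10 : A 1 0 = A 0 1 by rewrite -[in RHS]A_sym mxE.
rewrite !mxtrace2 !mxE !big_ord_recl !big_ord0.
have -> : lift ord0 ord0 = 1 :> 'I_2 by apply/val_inj.
by rewrite U11 U01 A10; ring.
Qed.

Lemma rotation_mxN1 (R : realType) : rotation_mx (- 1%:M : 'M[R]_2).
Proof.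
split; first by rewrite linearN /= trmx1 mulNmx mulmxN opprK mulmx1.
by rewrite -scaleN1r detZ det1 mulr1 sqrrN expr1n.
Qed.

Theorem proposition7 (R : realType) (A : 'M[R]_2) (A_sym : A^T = A) :
  (0 <= \tr A <->
     (count (fun x : R => x < 0)%R (real_eigenvalues A) <= 1)%N /\
     (forall l : R, l \in real_eigenvalues A -> l < 0 ->
        exists2 m : R, perm_eq (real_eigenvalues A) [:: l; m]
                     & `|l| <= `|m|)) /\
  (0 <= \tr A <-> maximal_trace A).
Proof.
split; last split.
- have [a [b [eigA <-]]] := sym_mx2_eigenvalues _ _ A_sym; clear A_sym.
  rewrite (permP eigA) /= addn0; split=> [ab_ge0 | [cnt dom]].
    split; first by case: (ltP a 0) => a0; case: (ltP b 0) => b0 //; lra.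
    move=> l; rewrite (perm_mem eigA) !inE => /orP[] /eqP -> l_lt0.
      exists b => //; rewrite ltr0_norm // ler_normr; apply/orP; left; lra.
    exists a; first by rewrite (perm_trans eigA) // (perm_catC [:: a] [:: b]).
    rewrite ltr0_norm // ler_normr; apply/orP; left; lra.
  (* The list has two entries, so the partner of l named by the hypothesis
     can only be m. *)
  have dominated (l m : R) : perm_eq (real_eigenvalues A) [:: l; m] ->
      l < 0 -> 0 <= m -> 0 <= l + m.
    move=> eigA' l_lt0 m_ge0.
    have lA : l \in real_eigenvalues A by rewrite (perm_mem eigA') mem_head.
    have [m' eigA''] := dom l lA l_lt0.
    have : perm_eq [:: l; m] [:: l; m'] by rewrite -(permPl eigA').
    rewrite perm_cons => /perm_mem /(_ m); rewrite !inE eqxx => /esym/eqP <-.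
    rewrite ltr0_norm // ger0_norm //; lra.
  case: (ltP a 0) cnt => a0; case: (ltP b 0) => b0 // _.
  + exact: dominated eigA _ _.
  + rewrite addrC; apply: dominated => //.
    by rewrite (perm_trans eigA) // (perm_catC [:: a] [:: b]).
  + exact: addr_ge0.
- move=> trA_ge0 U rotU; rewrite mxtrace_rotation_mx2 //.
  by have [_ _ U00_le1] := rotation_mx2_entries _ _ rotU; rewrite ler_piMl.
- (* The half turn of the plane has determinant one and negates the trace. *)
  move=> /(_ _ (rotation_mxN1 R)); rewrite mulNmx mul1mx linearN /= => ?; clear A_sym; lra.
Qed.
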